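(* For every integer $d\geq 1$ there exists a function $f_d:\mathbb{N}\to\mathbb{N}$ such that the following holds. Let $F=\{X_1,\dots,X_m\}$ be a family of finite sets in $\mathbb{R}^d$. If \[\varphi\Big(\bigcup_{i\in I}X_i\Big)\geq f_d(|I|)\] for every non-empty subset $I\subset\{1,\dots,m\}$, then $F$ has a system of general position representatives.
   Context: A subset $X\subset\mathbb{R}^d$ is in general position if every subset of $X$ of size at most $d+1$ is affinely independent. For a finite set $X\subset\mathbb{R}^d$, $\varphi(X)$ denotes the maximal size of a subset of $X$ in general position. For a family $F=\{X_1,\dots,X_m\}$ of finite sets in $\mathbb{R}^d$, a system of general position representatives is a set $\{x_1,\dots,x_m\}$ in general position (in particular consisting of $m$ distinct points) with $x_i\in X_i$ for all $1\le i\le m$. *)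

(* Defs.v *)
From mathcomp Require Import all_boot all_order all_algebra finmap.
From mathcomp Require Import boolp reals.

Set Implicit Arguments.
Unset Strict Implicit.
Unset Printing Implicit Defensive.

Import GRing.Theory.
Local Open Scope ring_scope.
Local Open Scope fset_scope.

Section GeneralPosition.
Context {R : realType} {d : nat}.
Implicit Types S X Y : {fset 'rV[R]_d}.

Definition affinely_independent S : Prop :=
  forall c : 'rV[R]_d -> R,
    \sum_(x <- S) c x = 0 -> \sum_(x <- S) c x *: x = 0 ->
    forall x, x \in S -> c x = 0.

Definition general_position X : Prop :=
  forall S, S `<=` X -> (#|` S| <= d.+1)%N -> affinely_independent S.

Definition phi X : nat :=
  (\max_(Y <- fpowerset X | `[< general_position Y >]) #|` Y|)%N.

Definition has_general_position_representatives
    (m : nat) (X : 'I_m -> {fset 'rV[R]_d}) : Prop :=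
  exists x : 'I_m -> 'rV[R]_d,
    [/\ forall i, x i \in X i,
        injective x
      & general_position [fset x i | i in 'I_m]].

End GeneralPosition.

(* Main.v *)
Require Import Defs.
From mathcomp Require Import all_boot all_order all_algebra finmap.
From mathcomp Require Import boolp reals.

Set Implicit Arguments.
Unset Strict Implicit.
Unset Printing Implicit Defensive.

Import GRing.Theory.
Local Open Scope fset_scope.
Local Open Scope ring_scope.

(** A family of sets can be ordered so that greedy selection works.  Since
[phi] is subadditive, if [phi] of the union of [k] sets is at least [k * N]
then one of the sets has [phi >= N]; put that set last and recurse on the
others.  When its turn comes, a set [Y] of [k - 1] points has been chosen, and
a new point is forbidden only if it lies in the affine span of a subset of [Y]
with at most [d] points.  Such a span meets a set in general position in at
most [d] points, so [N = 2 ^ (k - 1) * d + 1] leaves room for a choice. *)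

Lemma exists_fsubset_card (T : choiceType) (A : {fset T}) (k : nat) :
  (k <= #|` A|)%N -> exists2 B, B `<=` A & #|` B| = k.
Proof.
move=> le_kA; exists [fset x in take k A].
  by apply/fsubsetP=> x; rewrite inE => /mem_take.
by rewrite card_fseq undup_id ?take_uniq // size_takel.
Qed.

Lemma bigfcup_subadditive (T : choiceType) (h : {fset T} -> nat) (I : Type)
    (r : seq I) (P : pred I) (F : I -> {fset T}) :
  h fset0 = 0%N -> (forall A B, h (A `|` B) <= h A + h B)%N ->
  (h (\bigcup_(i <- r | P i) F i) <= \sum_(i <- r | P i) h (F i))%N.
Proof.
move=> h0 hU; elim/big_rec2: _ => [|i k A _ le_A]; first by rewrite h0.
by rewrite (leq_trans (hU _ _)) // leq_add2l.
Qed.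

Lemma leq_card_bigfcup (T : choiceType) (I : Type) (r : seq I) (P : pred I)
    (F : I -> {fset T}) :
  (#|` \bigcup_(i <- r | P i) F i| <= \sum_(i <- r | P i) #|` F i|)%N.
Proof.
apply: (bigfcup_subadditive (h := fun A : {fset T} => #|` A|)) => [|A B].
  exact: cardfs0.
exact: leq_card_fsetU.
Qed.

Lemma leq_sum_pigeonhole (I : finType) (J : {set I}) (F : I -> nat) (N : nat) :
  J != set0 -> (#|J| * N <= \sum_(i in J) F i)%N ->
  exists2 j, j \in J & (N <= F j)%N.
Proof.
move=> /set0Pn[i iJ] leNsum.
have [j jJ Fj_max] := arg_maxnP F iJ; exists j => //.
have J_gt0 : (0 < #|J|)%N by apply/card_gt0P; exists i.
rewrite -(leq_pmul2l J_gt0) (leq_trans leNsum) // -sum_nat_const.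
exact: leq_sum.
Qed.

Lemma underdetermined_system_neq0 (F : fieldType) (T U : choiceType)
    (A : {fset T}) (B : {fset U}) (a : T -> U -> F) :
  (#|` B| < #|` A|)%N ->
  exists2 c : T -> F, exists2 x, x \in A & c x != 0 &
    {in B, forall y, \sum_(x <- A) c x * a x y = 0}.
Proof.
rewrite !cardfE => ltBA.
pose M := \matrix_(i < #|{: A}|, j < #|{: B}|)
  a (val (enum_val i)) (val (enum_val j)).
have /rowV0Pn[v /sub_kermxP vM0 /rV0Pn[i vi_neq0]] : kermx M != 0.
  by rewrite kermx_eq0 /row_free neq_ltn (leq_ltn_trans (rank_leq_col _)).
pose c x := if insub x is Some s then v 0 (enum_rank (s : A)) else 0.
have cE (s : A) : c (val s) = v 0 (enum_rank s) by rewrite /c valK.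
exists c => [|y yB].
  by exists (val (enum_val i)); rewrite ?cE ?enum_valK ?fsvalP.
transitivity ((v *m M) 0 (enum_rank [`yB])); last by rewrite vM0 mxE.
rewrite mxE big_seq_fsetE /= (reindex_onto enum_val enum_rank) => [|s _] /=.
  apply: eq_big => [k|k _]; first by rewrite enum_valK eqxx.
  by rewrite cE enum_valK mxE enum_rankK.
exact: enum_rankK.
Qed.

Section AffineSpan.
Context {F : fieldType} {V : lmodType F}.
Implicit Types (S Z : {fset V}) (z : V) (c : V -> F).

Definition affine_span S : {pred V} := fun z =>
  `[< exists2 a : V -> F, \sum_(x <- S) a x = 1 & \sum_(x <- S) a x *: x = z >].

Lemma affine_spanP S z :
  reflect (exists2 a : V -> F,
             \sum_(x <- S) a x = 1 & \sum_(x <- S) a x *: x = z)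
          (z \in affine_span S).
Proof. exact: asboolP. Qed.

Lemma mem_affine_span S z : z \in S -> z \in affine_span S.
Proof.
move=> zS.
have sum_delta (W : nmodType) (g : V -> W) :
    \sum_(x <- S) g x *+ (x == z) = g z.
  under eq_bigr do rewrite mulrb.
  by rewrite -big_mkcond (fbig_pred1_inj (k := id)) //; apply: inj_id.
apply/affine_spanP; exists (fun x => (x == z)%:R); first exact: sum_delta.
by under eq_bigr do rewrite scaler_nat; apply: (sum_delta V id).
Qed.

Lemma mem_affine_span_dependency S z (b : F) c : b != 0 ->
  b + \sum_(x <- S) c x = 0 -> b *: z + \sum_(x <- S) c x *: x = 0 ->
  z \in affine_span S.
Proof.
move=> b_neq0 /eqP + /eqP; rewrite addrC addr_eq0 => /eqP sum_c.
rewrite addrC addr_eq0 => /eqP sum_cx.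
apply/affine_spanP; exists (fun x => - b^-1 * c x).
  by rewrite -mulr_sumr sum_c mulrNN mulVf.
under eq_bigr do rewrite -scalerA.
by rewrite -scaler_sumr sum_cx scaleNr scalerN opprK scalerA mulVf // scale1r.
Qed.

Lemma affine_span_dependency S Z :
  (#|` S| < #|` Z|)%N -> {subset Z <= affine_span S} ->
  exists c, [/\ exists2 z, z \in Z & c z != 0, \sum_(z <- Z) c z = 0
              & \sum_(z <- Z) c z *: z = 0].
Proof.
move=> ltSZ ZspanS.
have /choice[a aP] z : exists a, z \in Z ->
    \sum_(x <- S) a x = 1 /\ \sum_(x <- S) a x *: x = z.
  have [/ZspanS/affine_spanP[a a1 az]|] := boolP (z \in Z); first by exists a.
  by exists (fun=> 0).
have [c c_neq0 c_ker] := underdetermined_system_neq0 a ltSZ.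
exists c; split=> //.
- transitivity (\sum_(z <- Z) \sum_(x <- S) c z * a z x).
    by apply: eq_big_seq => z /aP[a1 _]; rewrite -mulr_sumr a1 mulr1.
  by rewrite exchange_big big_seq big1.
- transitivity (\sum_(z <- Z) \sum_(x <- S) (c z * a z x) *: x).
    apply: eq_big_seq => z /aP[_ az]; under eq_bigr do rewrite -scalerA.
    by rewrite -scaler_sumr az.
  rewrite exchange_big big_seq big1 // => x xS.
  by rewrite -scaler_suml c_ker // scale0r.
Qed.

End AffineSpan.

Section GeneralPositionTheory.
Context {R : realType} {d : nat}.
Implicit Types (S X Y Z : {fset 'rV[R]_d}) (z : 'rV[R]_d).

Lemma affinely_independent_card_le S Z :
  affinely_independent Z -> {subset Z <= affine_span S} ->
  (#|` Z| <= #|` S|)%N.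
Proof.
move=> indZ ZspanS; rewrite leqNgt; apply/negP => ltSZ.
have [c [[z zZ cz_neq0] sum_c sum_cz]] := affine_span_dependency ltSZ ZspanS.
by case/eqP: cz_neq0; apply: indZ.
Qed.

Lemma affinely_independentU1 S z :
  affinely_independent S -> z \notin affine_span S ->
  affinely_independent (z |` S).
Proof.
move=> indS zNspan c.
have zNS : z \notin S by apply: contra zNspan; apply: mem_affine_span.
rewrite !big_fsetU1 //= => sum_c sum_cx.
have cz0 : c z = 0.
  apply: contraNeq zNspan => cz_neq0.
  exact: mem_affine_span_dependency cz_neq0 sum_c sum_cx.
move: sum_c sum_cx; rewrite cz0 scale0r !add0r => sum_c sum_cx x.
by rewrite in_fset1U => /predU1P[->//|]; apply: indS.
Qed.

Lemma general_positionS X Y :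
  Y `<=` X -> general_position X -> general_position Y.
Proof. by move=> YX gpX S SY; apply: gpX; apply: fsubset_trans YX. Qed.

Lemma general_position0 : general_position (fset0 : {fset 'rV[R]_d}).
Proof. by move=> S /[!fsubset0]/eqP-> _ c _ _ x; rewrite inE. Qed.

Lemma general_positionU1 Y z : general_position Y ->
  (forall S, S `<=` Y -> (#|` S| <= d)%N -> z \notin affine_span S) ->
  general_position (z |` Y).
Proof.
move=> gpY zN S SzY leSd.
have SY : S `\ z `<=` Y by rewrite fsubDset.
have [zS|zNS] := boolP (z \in S); last first.
  by apply: gpY => //; rewrite mem_fsetD1 in SY.
have leS'd : (#|` S `\ z| <= d)%N by move: leSd; rewrite (cardfsD1 z) zS.
rewrite -(fsetD1K zS); apply: affinely_independentU1; last exact: zN.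
exact/gpY/leqW.
Qed.

Lemma general_position_card_affine_span S Z :
  general_position Z -> (#|` S| <= d)%N ->
  (#|` [fset z in Z | z \in affine_span S]| <= d)%N.
Proof.
move=> gpZ leSd; rewrite leqNgt; apply/negP.
move=> /exists_fsubset_card[B BZS cardB].
have BP z : z \in B -> z \in Z /\ z \in affine_span S.
  by move/(fsubsetP BZS); rewrite !inE /= => /andP.
have indB : affinely_independent B.
  by apply: gpZ; [apply/fsubsetP => z /BP[] | rewrite cardB].
have: (#|` B| <= #|` S|)%N.
  by apply: affinely_independent_card_le => // z /BP[].
by rewrite cardB leqNgt ltnS leSd.
Qed.

Lemma general_position_extend Y Z : (0 < d)%N ->
  general_position Y -> general_position Z ->
  (2 ^ #|` Y| * d < #|` Z|)%N ->
  exists z, [/\ z \in Z, z \notin Y & general_position (z |` Y)].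
Proof.
move=> d_gt0 gpY gpZ ltYZ.
pose forbidden := \bigcup_(S <- fpowerset Y | (#|` S| <= d)%N)
  [fset z in Z | z \in affine_span S].
have le_forbidden : (#|` forbidden| <= 2 ^ #|` Y| * d)%N.
  apply: leq_trans (leq_card_bigfcup _ _ _) _.
  rewrite -card_fpowerset -sum1_size big_distrl /= big_mkcond /=.
  apply: leq_sum => S _; rewrite mul1n.
  by case: ifP => // leSd; apply: general_position_card_affine_span.
have /fsubsetPn[z zZ z_allowed] : ~~ (Z `<=` forbidden).
  apply/negP => /fsubset_leq_card.
  by rewrite leqNgt (leq_ltn_trans le_forbidden).
have zN S : S `<=` Y -> (#|` S| <= d)%N -> z \notin affine_span S.
  move=> SY leSd; apply: contra z_allowed => zS; apply/bigfcupP; exists S.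
    by rewrite fpowersetE SY.
  by rewrite !inE /= zZ.
exists z; split=> //; last exact: general_positionU1.
apply/negP=> zY; have /negP[] : z \notin affine_span [fset z].
  by apply: zN; rewrite ?fsub1set ?cardfs1.
exact/mem_affine_span/fset11.
Qed.

Lemma leq_card_phi X Y :
  Y `<=` X -> general_position Y -> (#|` Y| <= phi X)%N.
Proof.
move=> YX gpY; rewrite /phi.
by apply: leq_bigmax_seq; [rewrite fpowersetE | apply/asboolP].
Qed.

Lemma phi_witness X :
  exists Y, [/\ Y `<=` X, general_position Y & #|` Y| = phi X].
Proof.
rewrite /phi big_seq_cond.
elim/big_ind: _ => [|m n|Y /andP[/[!fpowersetE] YX /asboolP gpY]].
- exists fset0; rewrite fsub0set cardfs0; split=> //.
  exact: general_position0.
- by rewrite /maxn; case: ifP.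
- by exists Y.
Qed.

Lemma phi0 : phi (fset0 : {fset 'rV[R]_d}) = 0%N.
Proof.
by have [Y [/[!fsubset0]/eqP-> _ <-]] := phi_witness fset0; rewrite cardfs0.
Qed.

Lemma phiU X Y : (phi (X `|` Y) <= phi X + phi Y)%N.
Proof.
have [Z [ZXY gpZ <-]] := phi_witness (X `|` Y).
have -> : Z = (Z `&` X) `|` (Z `&` Y).
  by rewrite -fsetIUr; apply/esym/fsetIidPl.
apply: leq_trans (leq_card_fsetU _ _) _.
by apply: leq_add; apply: leq_card_phi (fsubsetIr _ _) _;
  apply: general_positionS gpZ; apply: fsubsetIl.
Qed.

End GeneralPositionTheory.

Definition representatives_threshold (d k : nat) : nat :=
  (k * (2 ^ k.-1 * d).+1)%N.

Section Representatives.
Context {R : realType} {d : nat} {I : finType} (X : I -> {fset 'rV[R]_d}).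
Implicit Types (J : {set I}) (x : I -> 'rV[R]_d).

Definition representatives_on J x : Prop :=
  [/\ {in J, forall i, x i \in X i}, {in J &, injective x}
    & general_position [fset x i | i in J]].

Lemma representatives_on0 : representatives_on set0 (fun=> 0).
Proof.
split=> [i|i j|]; rewrite ?inE //; apply: general_positionS general_position0.
by apply/fsubsetP => y /imfsetP[i /=]; rewrite inE.
Qed.

Lemma representatives_onU1 J x j z :
  representatives_on J x -> j \notin J ->
  z \in X j -> z \notin [fset x i | i in J] ->
  general_position (z |` [fset x i | i in J]) ->
  representatives_on (j |: J) [eta x with j |-> z].
Proof.
move=> [xX injx _] jJ zX zNx gpz.
have J_neq i : i \in J -> i == j = false.
  by move=> iJ; apply: contraNF jJ => /eqP <-.
have zNeq i : i \in J -> z <> x i.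
  by move=> iJ zx; case/negP: zNx; apply/imfsetP; exists i.
split=> [i|i k|] /=.
- by rewrite !inE => /predU1P[->|iJ]; rewrite ?eqxx ?J_neq //; apply: xX.
- rewrite !inE => /predU1P[->|iJ] /predU1P[->|kJ]; rewrite ?eqxx ?J_neq //.
  + by move/zNeq: kJ.
  + by move/esym; move/zNeq: iJ.
  + exact: injx.
- apply: general_positionS gpz; apply/fsubsetP => y /imfsetP[i /= + ->].
  rewrite in_fset1U !inE => /predU1P[->|iJ]; first by rewrite !eqxx.
  by rewrite J_neq // in_imfset ?orbT.
Qed.

Lemma representatives_on_extend J x j : (0 < d)%N ->
  representatives_on J x -> j \notin J -> (2 ^ #|J| * d < phi (X j))%N ->
  exists y, representatives_on (j |: J) y.
Proof.
move=> d_gt0 repx jJ lt_phi; have [_ _ gpx] := repx.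
have [Z [ZX gpZ cardZ]] := phi_witness (X j).
have card_x : (#|` [fset x i | i in J]| <= #|J|)%N.
  by rewrite (leq_trans (leq_imfset_card _ _ _)) // -cardE.
have [|z [zZ zNx gpz]] := general_position_extend d_gt0 gpx gpZ.
  rewrite cardZ (leq_ltn_trans _ lt_phi) // leq_mul2r.
  by rewrite leq_exp2l // card_x orbT.
exists [eta x with j |-> z]; apply: representatives_onU1 => //.
exact: (fsubsetP ZX).
Qed.

Lemma exists_representatives_on J : (0 < d)%N ->
  (forall K : {set I}, K \subset J -> K != set0 ->
     (representatives_threshold d #|K| <= phi (\bigcup_(i in K) X i))%N) ->
  exists x, representatives_on J x.
Proof.
move=> d_gt0; have [n] := ubnP #|J|; elim: n J => // n IHn J ltJn phiX.
have [->|J_neq0] := eqVneq J set0.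
  by exists (fun=> 0); apply: representatives_on0.
have sum_phi : (representatives_threshold d #|J| <= \sum_(j in J) phi (X j))%N.
  apply: leq_trans (phiX J (subxx _) J_neq0) _.
  exact: bigfcup_subadditive phi0 phiU.
have [j jJ lt_phi] := leq_sum_pigeonhole J_neq0 sum_phi.
have cardJ : #|J| = #|J :\ j|.+1 by rewrite (cardsD1 j) jJ.
have [||x repx] := IHn (J :\ j); first by rewrite -ltnS -cardJ.
  by move=> K /subset_trans sKJ; apply/phiX/sKJ/subD1set.
rewrite -(setD1K jJ); apply: (representatives_on_extend d_gt0 repx).
  by rewrite !inE eqxx.
by rewrite cardJ in lt_phi.
Qed.

End Representatives.

Theorem theorem1p1 (R : realType) (d : nat) (hd : (1 <= d)%N) :
  exists f : nat -> nat,
    forall (m : nat) (X : 'I_m -> {fset 'rV[R]_d}),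
      (forall I : {set 'I_m}, I != set0 ->
         (f #|I| <= phi (\bigcup_(i in I) X i))%N) ->
      has_general_position_representatives X.
Proof.
exists (representatives_threshold d) => m X phiX.
have [K _|x [xX injx gpx]] := @exists_representatives_on _ _ _ X [set: 'I_m] hd.
  exact: phiX.
exists x; split=> [i|i j|]; [exact: xX|exact: injx|].
by congr general_position: gpx; apply: eq_imfset => // i; rewrite !inE.
Qed.
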